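(* Let $X$ be a topological space. For each of the following arrows $A\to B$: $$\Gamma^{BM}_f\to\Gamma^{BM}_k,\quad \Gamma^{BM}_k\to\Gamma^{BM}_p,\quad \Gamma^{BM}_p\to\Gamma^{BM}_o,\quad \Gamma^{BM}_k\to\Gamma^{OD}_{p,k},\quad \Gamma^{BM}_p\to\Gamma^{OD}_{p,l},\quad \Gamma^{BM}_o\to\Gamma^{OD}_{o,l},$$ $$\Gamma^{OD}_{p,k}\to\Gamma^{OD}_{o,k},\quad \Gamma^{OD}_{p,k}\to\Gamma^{OD}_{p,l},\quad \Gamma^{OD}_{o,k}\to\Gamma^{OD}_{o,l},\quad \Gamma^{OD}_{p,l}\to\Gamma^{OD}_{o,l},$$ the following hold: (1) if $X$ is $A$-nonmeager, then $X$ is $B$-nonmeager; (2) if $X$ is $A$-Baire, then $X$ is $B$-Baire; (3) if $X$ is an $A$-space, then $X$ is a $B$-space. Moreover, if $X$ is $\Gamma^{OD}_{o,l}$-nonmeager, then $X$ is nonmeager, and if $X$ is $\Gamma^{OD}_{o,l}$-Baire, then $X$ is Baire.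
   Context: Let $\mathcal T$ be the topology of $X$, $\mathcal T^*=\mathcal T\setminus\{\varnothing\}$, $\omega=\{0,1,2,\dots\}$. $X$ is Baire (nonmeager) if every countable intersection of dense open subsets of $X$ is dense (nonempty). $\mathfrak V(X)$: all sequences $(V_n)_{n\in\omega}$ in $\mathcal T^*$ with $V_{n+1}\subset V_n$. $\mathfrak V_{BM}(X)$: those $(V_n)\in\mathfrak V(X)$ with $\bigcap_nV_n\ne\varnothing$; $\mathfrak V_{BM}^*(X)=\mathfrak V(X)\setminus\mathfrak V_{BM}(X)$. $\mathfrak W(X)$: all sequences $(V_n,M_n)_{n\in\omega}$ with $V_n\in\mathcal T^*$, $\varnothing\neq M_n\subset X$, $V_{n+1}\subset V_n$, $M_{n+1}\subset V_n$. $\mathfrak W_e(X)$: those members of $\mathfrak W(X)$ with $\bigcap_nV_n=\varnothing$. For subsets $M_n\subset X$, $\overline{\mathrm{lt}}_{n}M_n$ is the set of $x\in X$ such that every neighborhood of $x$ meets $M_n$ for infinitely many $n$. For a nonprincipal ultrafilter $p$ on $\omega$ ($p\in\omega^*$), $x=\lim_p x_n$ means $\{n:x_n\in U\}\in p$ for every neighborhood $U$ of $x$. $\mathfrak W_l(X)$: those $(V_n,M_n)\in\mathfrak W(X)$ with $\overline{\mathrm{lt}}_nM_n\cap\bigcap_nV_n\neq\varnothing$. $\mathfrak W_k(X)$: those $(V_n,M_n)\in\mathfrak W(X)$ for which there are points $x_n\in M_n$ ($n\in\omega$) such that for every $p\in\omega^*$ there is $x\in\bigcap_nV_n$ with $x=\lim_px_n$.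 $\mathcal N_o(X)=\mathcal T^*$, $\mathcal N_p(X)=\{\{x\}:x\in X\}$. For $t\in\{o,p\}$, $\mathfrak V_t(X)$ is the set of $(V_n)\in\mathfrak V(X)$ such that $(V_n,M_n)_n\in\mathfrak W_l(X)$ whenever $M_n\in\mathcal N_t(X)$ and $M_n\subset V_n$ for all $n$. $\mathfrak V_f(X)$: those $(V_n)\in\mathfrak V_{BM}(X)$ such that for some $x\in\bigcap_nV_n$ the family $\{V_n\}$ is a base at $x$. $\mathfrak V_k(X)$: those $(V_n)\in\mathfrak V_{BM}(X)$ such that $M=\bigcap_nV_n$ is compact and $\{V_n\}$ is an outer base of $M$ (every open $W\supset M$ contains some $V_n$). Games (two players $\alpha$, $\beta$; strategies may depend on all previous moves). For $\mathcal V\subset\mathfrak V(X)$: in $BM(X,\mathcal V)$, $\alpha$ starts with $U_0=X$, in $MB(X,\mathcal V)$ with any $U_0\in\mathcal T^*$; $\beta$ answers $V_0\in\mathcal T^*$, $V_0\subset U_0$; on move $n\ge1$, $\alpha$ chooses $U_n\in\mathcal T^*$, $U_n\subset V_{n-1}$, then $\beta$ chooses $V_n\in\mathcal T^*$, $V_n\subset U_n$. $\alpha$ wins if $(V_n)\in\mathcal V$, otherwise $\beta$ wins. For a family $\mathcal N$ of nonempty sets such that each nonempty open set contains a member of $\mathcal N$, and $\mathcal W\subset\mathfrak W(X)$: $OD(X,\mathcal N,\mathcal W)$ and $DO(X,\mathcal N,\mathcal W)$ are played like $BM$ and $MB$ respectively, except that on every move $n$ player $\beta$ also chooses $M_n\in\mathcal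 N$ with $M_n\subset U_n$, and $\alpha$ wins if $(V_n,M_n)\in\mathcal W$, otherwise $\beta$ wins. A game is $\kappa$-favorable if player $\kappa$ has a winning strategy, and $\kappa$-unfavorable otherwise. For $r\in\{o,p,f,k\}$, $X$ is: $\Gamma^{BM}_r$-nonmeager if $MB(X,\mathfrak V_r(X))$ is $\beta$-unfavorable; $\Gamma^{BM}_r$-Baire if $BM(X,\mathfrak V_r(X))$ is $\beta$-unfavorable; a $\Gamma^{BM}_r$-space if $BM(X,\mathfrak V_r(X)\cup\mathfrak V_{BM}^*(X))$ is $\alpha$-favorable. For $t\in\{o,p\}$, $q\in\{l,k\}$, $X$ is: $\Gamma^{OD}_{t,q}$-nonmeager if $DO(X,\mathcal N_t(X),\mathfrak W_q(X))$ is $\beta$-unfavorable; $\Gamma^{OD}_{t,q}$-Baire if $OD(X,\mathcal N_t(X),\mathfrak W_q(X))$ is $\beta$-unfavorable; a $\Gamma^{OD}_{t,q}$-space if $OD(X,\mathcal N_t(X),\mathfrak W_q(X)\cup\mathfrak W_e(X))$ is $\alpha$-favorable. *)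

(* Defs.v *)
From mathcomp Require Import all_boot all_order.
From mathcomp Require Import boolp classical_sets functions cardinality filter.
From mathcomp Require Import topology.
Set Implicit Arguments.
Unset Strict Implicit.
Unset Printing Implicit Defensive.
Local Open Scope classical_set_scope.

(* Two-player games of length omega: in round n, [alpha] makes a move in       *)
(* [amove], then [beta] answers in [bmove].  A position is the list of the     *)
(* completed rounds, MOST RECENT ROUND FIRST.                                  *)
Record game := Game {
  amove : Type;
  bmove : Type;
  alegal : seq (amove * bmove) -> amove -> Prop;
  blegal : seq (amove * bmove) -> amove -> bmove -> Prop;
  alpha_wins : set (nat -> amove * bmove) }.

Fixpoint past (T : Type) (play : nat -> T) (n : nat) : seq T :=
  if n is m.+1 then play m :: past play m else [::].

Section Strategies.
Variable G : game.
Notation position := (seq (amove G * bmove G)).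
Notation alpha_strategy := (position -> amove G).
Notation beta_strategy := (position -> amove G -> bmove G).

(* Positions reachable when the strategy's owner follows it and the opponent   *)
(* moves legally.  Strategies are total functions, but only their values at    *)
(* these positions matter.                                                     *)
Inductive alpha_pos (s : alpha_strategy) : position -> Prop :=
| alpha_pos_nil : alpha_pos s [::]
| alpha_pos_cons h b :
    alpha_pos s h -> blegal h (s h) b -> alpha_pos s ((s h, b) :: h).

Inductive beta_pos (s : beta_strategy) : position -> Prop :=
| beta_pos_nil : beta_pos s [::]
| beta_pos_cons h a :
    beta_pos s h -> alegal h a -> beta_pos s ((a, s h a) :: h).

Definition alpha_winning (s : alpha_strategy) : Prop :=
  (forall h, alpha_pos s h -> alegal h (s h)) /\
  (forall play, (forall n, alpha_pos s (past play n)) ->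
     alpha_wins play).

Definition beta_winning (s : beta_strategy) : Prop :=
  (forall h a, beta_pos s h -> alegal h a -> blegal h a (s h a)) /\
  (forall play, (forall n, beta_pos s (past play n)) ->
     ~ alpha_wins play).

Definition alpha_favorable : Prop := exists s, alpha_winning s.
Definition beta_favorable : Prop := exists s, beta_winning s.
Definition beta_unfavorable : Prop := ~ beta_favorable.
End Strategies.

Section Families.
Variable X : topologicalType.

Definition Tstar : set (set X) := [set U | open U /\ U !=set0].

Definition frakV : set (nat -> set X) :=
  [set V | forall n, Tstar (V n) /\ V n.+1 `<=` V n].

Definition frakV_BM : set (nat -> set X) :=
  [set V | frakV V /\ (\bigcap_n V n) !=set0].

Definition frakV_BMstar : set (nat -> set X) := frakV `\` frakV_BM.

(* The n-th term of a sequence of pairs is (V_n, M_n). *)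
Definition frakW : set (nat -> set X * set X) :=
  [set W | forall n, [/\ Tstar (W n).1, (W n).2 !=set0,
     (W n.+1).1 `<=` (W n).1 & (W n.+1).2 `<=` (W n).1]].

Definition frakW_e : set (nat -> set X * set X) :=
  [set W | frakW W /\ \bigcap_n (W n).1 = set0].

Definition upper_lt (M : nat -> set X) : set X :=
  [set x | forall U, nbhs x U -> infinite_set [set n | (M n `&` U) !=set0]].

Definition frakW_l : set (nat -> set X * set X) :=
  [set W | frakW W /\
    (upper_lt (fun n => (W n).2) `&` \bigcap_n (W n).1) !=set0].

Definition nonprincipal (p : set_system nat) : Prop :=
  forall n, ~ p [set n].

(* [x_ @ p --> x] unfolds to: x_ @^-1` U belongs to p for each nbhs U of x. *)
Definition frakW_k : set (nat -> set X * set X) :=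
  [set W | frakW W /\
    exists x_ : nat -> X, (forall n, (W n).2 (x_ n)) /\
      forall p : set_system nat, UltraFilter p -> nonprincipal p ->
        exists2 x, (\bigcap_n (W n).1) x & x_ @ p --> x].

Definition calN_o : set (set X) := Tstar.
Definition calN_p : set (set X) := [set [set x] | x in [set: X]].

Definition frakV_t (N : set (set X)) : set (nat -> set X) :=
  [set V | frakV V /\
    forall M : nat -> set X, (forall n, N (M n) /\ M n `<=` V n) ->
      frakW_l (fun n => (V n, M n))].

Definition frakV_f : set (nat -> set X) :=
  [set V | frakV_BM V /\
    exists2 x, (\bigcap_n V n) x &
      forall U, nbhs x U -> exists n, V n `<=` U].

Definition frakV_k : set (nat -> set X) :=
  [set V | [/\ frakV_BM V, compact (\bigcap_n V n) &
    forall U, open U -> \bigcap_n V n `<=` U -> exists n, V n `<=` U]].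

Definition nested_alegal (B : Type) (cur : B -> set X) (start : set (set X))
    (h : seq (set X * B)) (U : set X) : Prop :=
  if h is (_, b) :: _ then Tstar U /\ U `<=` cur b else start U.

Definition BM_game (start : set (set X)) (V : set (nat -> set X)) : game :=
  @Game (set X) (set X)
    (nested_alegal id start)
    (fun _ Un Vn => Tstar Vn /\ Vn `<=` Un)
    [set play | V (fun n => (play n).2)].

Definition OD_game (start : set (set X)) (N : set (set X))
    (W : set (nat -> set X * set X)) : game :=
  @Game (set X) (set X * set X)
    (nested_alegal fst start)
    (fun _ Un VMn => [/\ Tstar VMn.1, VMn.1 `<=` Un, N VMn.2 & VMn.2 `<=` Un])
    [set play | W (fun n => (play n).2)].

Definition BM (V : set (nat -> set X)) := BM_game [set [set: X]] V.
Definition MB (V : set (nat -> set X)) := BM_game Tstar V.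
Definition OD (N : set (set X)) (W : set (nat -> set X * set X)) :=
  OD_game [set [set: X]] N W.
Definition DO (N : set (set X)) (W : set (nat -> set X * set X)) :=
  OD_game Tstar N W.
End Families.

Inductive bm_index := bm_o | bm_p | bm_f | bm_k.
Inductive t_index := t_o | t_p.
Inductive q_index := q_l | q_k.

Definition calN (X : topologicalType) (t : t_index) : set (set X) :=
  match t with t_o => @calN_o X | t_p => @calN_p X end.
Arguments calN X t : clear implicits.

Definition frakV_of (X : topologicalType) (r : bm_index) : set (nat -> set X) :=
  match r with
  | bm_o => frakV_t (calN X t_o)
  | bm_p => frakV_t (calN X t_p)
  | bm_f => @frakV_f X
  | bm_k => @frakV_k X
  end.
Arguments frakV_of X r : clear implicits.

Definition frakW_of (X : topologicalType) (q : q_index) :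
    set (nat -> set X * set X) :=
  match q with q_l => @frakW_l X | q_k => @frakW_k X end.
Arguments frakW_of X q : clear implicits.

Inductive Gamma := Gamma_BM (r : bm_index) | Gamma_OD (t : t_index) (q : q_index).

Definition Gamma_nonmeager (A : Gamma) (X : topologicalType) : Prop :=
  match A with
  | Gamma_BM r => beta_unfavorable (MB (frakV_of X r))
  | Gamma_OD t q => beta_unfavorable (DO (calN X t) (frakW_of X q))
  end.

Definition Gamma_Baire (A : Gamma) (X : topologicalType) : Prop :=
  match A with
  | Gamma_BM r => beta_unfavorable (BM (frakV_of X r))
  | Gamma_OD t q => beta_unfavorable (OD (calN X t) (frakW_of X q))
  end.

Definition Gamma_space (A : Gamma) (X : topologicalType) : Prop :=
  match A with
  | Gamma_BM r => alpha_favorable (BM (frakV_of X r `|` @frakV_BMstar X))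
  | Gamma_OD t q =>
      alpha_favorable (OD (calN X t) (frakW_of X q `|` @frakW_e X))
  end.

Inductive Gamma_arrow : Gamma -> Gamma -> Prop :=
| BMf_BMk : Gamma_arrow (Gamma_BM bm_f) (Gamma_BM bm_k)
| BMk_BMp : Gamma_arrow (Gamma_BM bm_k) (Gamma_BM bm_p)
| BMp_BMo : Gamma_arrow (Gamma_BM bm_p) (Gamma_BM bm_o)
| BMk_ODpk : Gamma_arrow (Gamma_BM bm_k) (Gamma_OD t_p q_k)
| BMp_ODpl : Gamma_arrow (Gamma_BM bm_p) (Gamma_OD t_p q_l)
| BMo_ODol : Gamma_arrow (Gamma_BM bm_o) (Gamma_OD t_o q_l)
| ODpk_ODok : Gamma_arrow (Gamma_OD t_p q_k) (Gamma_OD t_o q_k)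
| ODpk_ODpl : Gamma_arrow (Gamma_OD t_p q_k) (Gamma_OD t_p q_l)
| ODok_ODol : Gamma_arrow (Gamma_OD t_o q_k) (Gamma_OD t_o q_l)
| ODpl_ODol : Gamma_arrow (Gamma_OD t_p q_l) (Gamma_OD t_o q_l).

Definition Baire_space (X : topologicalType) : Prop :=
  forall F : nat -> set X,
    (forall n, open (F n) /\ dense (F n)) -> dense (\bigcap_n F n).

Definition nonmeager_space (X : topologicalType) : Prop :=
  forall F : nat -> set X,
    (forall n, open (F n) /\ dense (F n)) -> (\bigcap_n F n) !=set0.

(* Main.v *)
Require Import Defs.
From mathcomp Require Import all_boot all_order.
From mathcomp Require Import boolp classical_sets functions cardinality filter.
From mathcomp Require Import topology.
Set Implicit Arguments.
Unset Strict Implicit.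
Unset Printing Implicit Defensive.
Local Open Scope classical_set_scope.

(** The games compared here differ only in what beta has to record and in which
    runs alpha wins.  Suppose that every legal beta move [b] of a game [B] can be
    read as a legal beta move [pi b] of a game [A] leaving the same open set to
    alpha, and that a run of [B] is won by alpha as soon as its image under [pi]
    is a run of [A] won by alpha.  Then a winning strategy of alpha in [A] becomes
    one in [B] by looking at the opponent through [pi] ([alpha_transfer]), and a
    winning strategy of beta in [B] becomes one in [A] by passing the answers
    through [pi] ([beta_transfer]).  The first fact settles the spaces, the second
    the nonmeager and the Baire case, which are about the absence of winning
    strategies of beta.  The runs that alpha wins in the definition of the spaces
    because the [V_n] have no common point correspond to each other, since [pi]
    does not change [V_n].

    For an arrow between two BM-games, or between two OD-games with the same
    family of sets, [pi] is the identity; from a BM-game to an OD-game, [pi]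
    forgets the set [M_n]; from points to open sets, [pi] replaces [M_n] by a
    singleton inside it.  What remains is a comparison of winning conditions.
    Its only substantial part concerns the compact condition: if the [V_n] form
    an outer base of the compact set [K], their intersection, then every sequence
    that is eventually in each [V_m] has a cluster point in [K] along every
    proper filter on [nat] ([outer_base_cluster]).  Along the filter of cofinite
    sets this yields a point of the upper limit, along an ultrafilter a limit.
    Conversely, a limit along a single nonprincipal ultrafilter lies in the upper
    limit, because the members of such an ultrafilter are infinite.

    If open dense sets [F_n] have an intersection missing a nonempty open set
    [O], then beta wins the weakest game by staying inside [O] and playing inside
    [F_n] on move [n] ([category_beta_favorable]): the sets [V_n] then have no
    common point. *)

(** * Transfer of strategies *)

Lemma alpha_pos_consE (G : game) (s : seq (amove G * bmove G) -> amove G) h ab :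
  alpha_pos s (ab :: h) -> [/\ alpha_pos s h, ab.1 = s h & blegal h ab.1 ab.2].
Proof. by move=> H; inversion H. Qed.

Lemma beta_pos_consE (G : game)
    (s : seq (amove G * bmove G) -> amove G -> bmove G) h ab :
  beta_pos s (ab :: h) -> [/\ beta_pos s h, ab.2 = s h ab.1 & alegal h ab.1].
Proof. by move=> H; inversion H. Qed.

Section NestedGames.
Variable X : topologicalType.

(** Common shape of [BM_game] and [OD_game], both of which are instances of it
    by conversion. *)
Definition nested_game (B : Type) (cur : B -> set X) (start : set (set X))
    (ok : set X -> B -> Prop) (W : set (nat -> B)) : game :=
  @Game (set X) B (nested_alegal cur start) (fun _ U b => ok U b)
    [set play | W (fun n => (play n).2)].

Definition legal_run (B : Type) (cur : B -> set X) (ok : set X -> B -> Prop)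
    (b : nat -> B) : Prop :=
  exists U : nat -> set X, forall n,
    [/\ ok (U n) (b n), Tstar (U n.+1) & U n.+1 `<=` cur (b n)].

Section Transfer.
Variables (B1 B2 : Type) (cur1 : B1 -> set X) (cur2 : B2 -> set X).
Variables (ok1 : set X -> B1 -> Prop) (ok2 : set X -> B2 -> Prop).
Variables (W1 : set (nat -> B1)) (W2 : set (nat -> B2)) (pi : B2 -> B1).
Variable start : set (set X).
Hypothesis cur_pi : forall b, cur1 (pi b) = cur2 b.
Hypothesis ok_pi : forall U b, ok2 U b -> ok1 U (pi b).
Hypothesis win_pi :
  forall b, legal_run cur2 ok2 b -> W1 (pi \o b) -> W2 b.

Local Notation G1 := (nested_game cur1 start ok1 W1).
Local Notation G2 := (nested_game cur2 start ok2 W2).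

Let push (h : seq (set X * B2)) : seq (set X * B1) :=
  [seq (ab.1, pi ab.2) | ab <- h].

Lemma nested_alegal_push h U :
  nested_alegal cur1 start (push h) U <-> nested_alegal cur2 start h U.
Proof. by case: h => [|[a b] h] //=; rewrite cur_pi. Qed.

Lemma alpha_transfer : alpha_favorable G1 -> alpha_favorable G2.
Proof.
case=> s [s_legal s_win].
pose s2 : seq (set X * B2) -> set X := fun h => s (push h).
have pos_push h : @alpha_pos G2 s2 h -> @alpha_pos G1 s (push h).
  elim=> [|{}h b _ IH okb]; first exact: alpha_pos_nil.
  by apply: (@alpha_pos_cons G1) => //; exact: ok_pi.
have s2_legal h : @alpha_pos G2 s2 h -> nested_alegal cur2 start h (s2 h).
  by move=> /pos_push /s_legal ?; apply/nested_alegal_push.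
exists s2; split=> // play hplay.
apply: win_pi.
  exists (fun n => (play n).1) => n.
  have [hn1 a_eq _] := alpha_pos_consE (hplay n.+2).
  have [_ _ okn] := alpha_pos_consE hn1.
  have := s2_legal _ hn1.
  rewrite -a_eq /=.
  by case: (play n) okn => a b /= okn [].
apply: (s_win (fun n => ((play n).1, pi (play n).2))) => n.
suff -> : past (fun n => ((play n).1, pi (play n).2)) n = push (past play n).
  exact: pos_push.
by elim: n => //= n ->.
Qed.

(** Beta does not see, in [G1], the moves that the strategy for [G2] would have
    made; they are recomputed from the moves of alpha. *)
Lemma beta_transfer : beta_favorable G2 -> beta_favorable G1.
Proof.
case=> s [s_legal s_win].
pose sim : seq (set X * B1) -> seq (set X * B2) :=
  foldr (fun ab h => (ab.1, s h ab.1) :: h) [::].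
pose s1 : seq (set X * B1) -> set X -> B1 := fun h a => pi (s (sim h) a).
have pos_sim h : @beta_pos G1 s1 h -> @beta_pos G2 s (sim h) /\ push (sim h) = h.
  elim=> [|{}h a _ [IH1 IH2] la]; first by split=> //; exact: beta_pos_nil.
  split; last by rewrite /= IH2.
  apply: (@beta_pos_cons G2) => //.
  by apply/nested_alegal_push; rewrite IH2.
exists s1; split=> [h a /pos_sim[hpos hpush] la|play hplay].
  apply: ok_pi; apply: s_legal => //.
  by apply/nested_alegal_push; rewrite hpush.
pose play2 n := ((play n).1, s (sim (past play n)) (play n).1).
have past2 n : past play2 n = sim (past play n) by elim: n => //= n ->.
have hplay2 n : @beta_pos G2 s (past play2 n).
  by rewrite past2; case: (pos_sim _ (hplay n)).
move=> W1play; apply: (s_win play2 hplay2); apply: win_pi.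
  exists (fun n => (play n).1) => n.
  have [hn1 _ [TU UV]] := beta_pos_consE (hplay2 n.+2).
  have [hn _ la] := beta_pos_consE hn1.
  by split=> //; rewrite /= -past2; exact: s_legal.
rewrite (_ : _ \o _ = fun n => (play n).2)//.
apply/funext => n /=.
by have [_ -> _] := beta_pos_consE (hplay n.+1).
Qed.

End Transfer.
End NestedGames.

(** * Sequences and filters on the natural numbers *)

Lemma infinite_natP (S : set nat) :
  infinite_set S <-> forall N, exists2 n, (N <= n)%N & S n.
Proof.
split=> [Sinf N|Sunb].
  apply: contrapT => noS; apply: Sinf.
  apply: (@sub_finite_set _ _ `I_N); last exact: finite_II.
  move=> n Sn /=; rewrite ltnNge; apply/negP => Nn.
  by apply: noS; exists n.
move=> /finite_seqP[s Ss].
have [n ltn Sn] := Sunb (\max_(i <- s) i).+1.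
have ns : n \in s by move: Sn; rewrite Ss.
by move: ltn; rewrite ltnNge (@leq_bigmax_seq nat s xpredT id n ns isT).
Qed.

Lemma nonprincipal_eventually (p : set_system nat) :
  UltraFilter p -> nonprincipal p -> \oo `<=` p.
Proof.
move=> pU pN S [N _ NS].
suff: p [set n | (N <= n)%N] by apply: filterS.
elim: {S NS} N => [|N IH]; first by apply: filterS filterT.
have [/pN//|pNC] := in_ultra_setVsetC [set N] pU.
apply: filterS (filterI IH pNC) => n /= [Nn nN].
by rewrite ltn_neqAle Nn andbT; apply/eqP => /esym.
Qed.

Lemma infinite_of_eventually (p : set_system nat) (S : set nat) :
  ProperFilter p -> \oo `<=` p -> p S -> infinite_set S.
Proof.
move=> pF oop pS; apply/infinite_natP => N.
have pN : p [set n | (N <= n)%N] by apply: oop; exists N.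
by have [n []] := filter_ex (filterI pN pS); exists n.
Qed.

Lemma exists_nonprincipal :
  exists p : set_system nat, [/\ UltraFilter p, nonprincipal p & \oo `<=` p].
Proof.
have [p [pU oop]] := @ultraFilterLemma nat \oo _.
exists p; split=> // n pn.
by apply: (infinite_of_eventually ultra_proper oop pn); exact: finite_set1.
Qed.

(** * Comparison of the winning conditions *)

Section Conditions.
Variable X : topologicalType.
Implicit Types (V : nat -> set X) (W : nat -> set X * set X).

Lemma nested_subset V : (forall n, V n.+1 `<=` V n) ->
  forall m n, (m <= n)%N -> V n `<=` V m.
Proof.
move=> Vdec m n /subnK <-; elim: (n - m)%N => [|k IH] //=.
by rewrite addSn; apply: subset_trans IH; exact: Vdec.
Qed.

(** The sets [K `&` closure (x @` S)], for [S] in [p], generate a proper filter: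
    if one of them were empty, the complement of the closure would be an open set
    containing [K], hence some [V m], hence [x n] for some [n] in [S]. *)
Lemma outer_base_cluster (K : set X) V (p : set_system nat) (x : nat -> X) :
  compact K ->
  (forall U, open U -> K `<=` U -> exists n, V n `<=` U) ->
  ProperFilter p -> (forall m, \forall n \near p, V m (x n)) ->
  (K `&` cluster (x @ p)) !=set0.
Proof.
move=> Kc Kbase pF xV.
pose trace S := K `&` closure (x @` S).
have traceS S T : S `<=` T -> trace S `<=` trace T.
  by move=> ST; apply: setIS; apply: closureS; exact: image_subset.
have trace_filter : ProperFilter (filter_from p trace).
  apply: filter_from_proper => [|S pS].
    apply: filter_from_filter; first by exists setT; exact: filterT.
    move=> S T pS pT; exists (S `&` T); first exact: filterI.
    by rewrite subsetI; split; apply: traceS.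
  apply: contrapT => noK.
  have [m Vm] : exists m, V m `<=` ~` closure (x @` S).
    apply: Kbase; first exact/closed_openC/closed_closure.
    by move=> y Ky cly; apply: noK; exists y.
  have [n [Vxn Sn]] := filter_ex (filterI (xV m) pS).
  by apply: (Vm _ Vxn); apply: subset_closure; exists n.
have [|y [Ky cly]] := Kc _ trace_filter.
  by exists setT; [exact: filterT|exact: subIsetl].
exists y; split=> // A U pA yU.
have [z [[_ clz] Uz]] : trace (x @^-1` A) `&` interior U !=set0.
  apply: cly; last exact: nbhs_interior.
  by exists (x @^-1` A).
have [_ [[n An <-] Un]] := clz U Uz.
by exists (x n).
Qed.

Lemma cluster_upper_lt (x : nat -> X) (M : nat -> set X)
    (p : set_system nat) y :
  ProperFilter p -> \oo `<=` p -> (forall n, M n (x n)) ->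
  cluster (x @ p) y -> upper_lt M y.
Proof.
move=> pF oop xM cly U yU; apply/infinite_natP => N.
have pN : (x @ p) (x @` [set n | (N <= n)%N]).
  by apply: oop; exists N => // n Nn; exists n.
have [_ [[n Nn <-] Ux]] := cly _ _ pN yU.
by exists n => //; exists (x n).
Qed.

Lemma frakV_f_sub_k : @frakV_f X `<=` @frakV_k X.
Proof.
move=> V [VBM [x Vx xbase]]; split=> //.
  move=> F FF FV; exists x; split=> // A U FA xU.
  have [n Vn] := xbase U xU.
  have [y [Ay Vy]] := filter_ex (filterI FA FV).
  by exists y; split=> //; apply: Vn; exact: Vy.
by move=> U Uo VU; apply: xbase; apply: open_nbhs_nbhs; split=> //; exact: VU.
Qed.

Lemma frakW_nested V (M : nat -> set X) : frakV V -> (forall n, M n !=set0) ->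
  (forall n, M n `<=` V n) -> frakW (fun n => (V n, M n)).
Proof.
move=> hV M0 MV n; have [? ?] := hV n; have [_ VS] := hV n.
by split=> //=; apply: subset_trans VS; exact: MV.
Qed.

Lemma frakV_k_sub_p : @frakV_k X `<=` frakV_t (calN X t_p).
Proof.
move=> V [[hV _] Kc Kbase]; split=> // M hM.
have [x xM] : exists x : nat -> X, forall n, M n = [set x n].
  suff /choice[x] : forall n, exists y, M n = [set y] by exists x.
  by move=> n; have [[y _ <-] _] := hM n; exists y.
have xV n : V n (x n) by apply: (hM n).2; rewrite xM.
split.
  by apply: frakW_nested => // n; [exists (x n); rewrite xM|exact: (hM n).2].
have [|y [Ky cly]] := @outer_base_cluster _ V \oo x Kc Kbase _.
  move=> m; exists m => // n /nested_subset; apply; last exact: xV.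
  by move=> k; exact: (hV k).2.
exists y; split=> //.
by apply: (cluster_upper_lt _ _ _ cly) => // n; rewrite /= xM.
Qed.

Lemma upper_lt_subset (M N : nat -> set X) : (forall n, M n `<=` N n) ->
  upper_lt M `<=` upper_lt N.
Proof.
move=> MN x xM U /xM; apply: sub_infinite_set => n [y [My Uy]].
by exists y; split=> //; exact: MN.
Qed.

(** One choice of a point per set, independent of the position, so that it can
    serve as a translation of moves. *)
Lemma singleton_selection :
  exists sel : set X -> set X, forall M, M !=set0 ->
    calN X t_p (sel M) /\ sel M `<=` M.
Proof.
have /choice[sel selP] : forall M : set X, exists S, M !=set0 ->
    calN X t_p S /\ S `<=` M.
  move=> M; have [[x Mx]|M0] := pselect (M !=set0); last by exists set0.
  by exists [set x] => _; split; [exists x|move=> _ ->].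
by exists sel.
Qed.

Lemma frakV_p_sub_o : frakV_t (calN X t_p) `<=` frakV_t (calN X t_o).
Proof.
move=> V [hV Vwin]; split=> // M hM.
have M0 n : M n !=set0 by case: (hM n) => -[].
have [sel selP] := singleton_selection.
have [|_ [y [ly Vy]]] := Vwin (sel \o M).
  move=> n; have [? sM] := selP _ (M0 n).
  by split=> //; apply: subset_trans sM (hM n).2.
split; first by apply: frakW_nested => // n; exact: (hM n).2.
exists y; split=> //; apply: upper_lt_subset ly => n.
by case: (selP _ (M0 n)).
Qed.

Lemma frakW_k_of_V W : frakW W -> frakV_k (fun n => (W n).1) -> frakW_k W.
Proof.
move=> hW [[hV _] Kc Kbase]; split=> //.
have /choice[x xM] : forall n, exists y, (W n).2 y.
  by move=> n; case: (hW n) => _ [y My] _ _; exists y.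
exists x; split=> // p pU pN.
have pF : ProperFilter p := @ultra_proper _ _ pU.
have [|y [Ky cly]] := @outer_base_cluster _ _ p x Kc Kbase pF.
  (* The first set M_0 need not lie in V_0, so the points are in V_m from the
     index m + 1 on. *)
  move=> m; apply: (nonprincipal_eventually pU pN).
  exists m.+1 => // -[|n] //= mn.
  apply: (@nested_subset (fun n => (W n).1) _ m n mn) => [k|].
    exact: (hV k).2.
  by case: (hW n) => _ _ _; apply; exact: xM.
exists y => // U yU.
have [//|pnU] := in_ultra_setVsetC (x @^-1` U) pU.
by have [z [nUz /nUz]] := cly _ _ (pnU : (x @ p) (~` U)) yU.
Qed.

(** The definition of [frakV_t] is applied to the shifted sequence [M_{n+1}],
    because [M_n] is only known to lie in [V_{n-1}]. *)
Lemma frakW_l_of_V (N : set (set X)) W : (forall n, N (W n).2) -> frakW W ->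
  frakV_t N (fun n => (W n).1) -> frakW_l W.
Proof.
move=> NW hW [_ /(_ (fun n => (W n.+1).2))[]].
  by move=> n; split=> //; case: (hW n).
move=> _ [y [ly Vy]]; split=> //; exists y; split=> // U /ly /infinite_natP h.
apply/infinite_natP => k; have [n kn Un] := h k.
by exists n.+1 => //; exact: leqW.
Qed.

Lemma frakW_k_sub_l : @frakW_k X `<=` @frakW_l X.
Proof.
move=> W [hW [x [xM xlim]]]; split=> //.
have [p [pU pN oop]] := exists_nonprincipal.
have pF : ProperFilter p := @ultra_proper _ _ pU.
have [y Vy xy] := xlim p pU pN.
exists y; split=> //; apply: (cluster_upper_lt pF oop xM).
move=> A U pA /xy pU'.
exact: (@filter_ex _ (x @ p) _ _ (filterI pA pU')).
Qed.

Lemma frakW_of_shrink (sel : set X -> set X) q W : frakW W ->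
  (forall n, sel (W n).2 `<=` (W n).2) ->
  frakW_of X q (fun n => ((W n).1, sel (W n).2)) -> frakW_of X q W.
Proof.
move=> hW selW; case: q => -[_].
  by case=> y [ly Vy]; split=> //; exists y; split=> //; exact: upper_lt_subset ly.
case=> x [xM xlim]; split=> //; exists x; split=> // n.
exact/selW/xM.
Qed.

(** * Arrows between the games *)

Lemma legal_frakV V :
  legal_run id (fun U S => Tstar S /\ S `<=` U) V -> frakV V.
Proof.
case=> U hU n; have [[TV _] _ UV] := hU n; have [[_ VU] _ _] := hU n.+1.
by split=> //; exact: subset_trans UV.
Qed.

Definition OD_ok (N : set (set X)) (U : set X) (b : set X * set X) : Prop :=
  [/\ Tstar b.1, b.1 `<=` U, N b.2 & b.2 `<=` U].

Lemma calN_nonempty t (M : set X) : calN X t M -> M !=set0.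
Proof. by case: t => [[]//|[x _ <-]]; exists x. Qed.

Lemma legal_frakW t W :
  legal_run fst (OD_ok (calN X t)) W ->
  frakW W /\ forall n, calN X t (W n).2.
Proof.
case=> U hU; split=> n; have [[TV _ NM _] _ UV] := hU n => //.
have [[_ VU _ MU] _ _] := hU n.+1.
split=> //; first exact: calN_nonempty NM.
  exact: subset_trans UV.
exact: subset_trans UV.
Qed.

Lemma frakV_BMstar_set0 V : frakV_BMstar V -> \bigcap_n V n = set0.
Proof.
by case=> hV nV; apply/eqP/negPn/negP => /set0P ?; apply: nV.
Qed.

Definition all_transfer (A B : Gamma) : Prop :=
  [/\ Gamma_nonmeager A X -> Gamma_nonmeager B X,
      Gamma_Baire A X -> Gamma_Baire B X
    & Gamma_space A X -> Gamma_space B X].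

Lemma BM_BM_transfer r r' : frakV_of X r `<=` frakV_of X r' ->
  all_transfer (Gamma_BM r) (Gamma_BM r').
Proof.
move=> rr'; split; [apply: contra_not|apply: contra_not|].
- by apply: (@beta_transfer X _ _ id id _ _ _ _ id) => // V _; exact: rr'.
- by apply: (@beta_transfer X _ _ id id _ _ _ _ id) => // V _; exact: rr'.
- apply: (@alpha_transfer X _ _ id id _ _ _ _ id) => // V _.
  by case=> [/rr'|]; [left|right].
Qed.

Lemma BM_OD_transfer r t q :
  (forall W, frakW W -> (forall n, calN X t (W n).2) ->
     frakV_of X r (fun n => (W n).1) -> frakW_of X q W) ->
  all_transfer (Gamma_BM r) (Gamma_OD t q).
Proof.
move=> rq; split; [apply: contra_not|apply: contra_not|].
- apply: (@beta_transfer X _ _ id fst _ _ _ _ fst) => // [U b []//|W].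
  by move=> /legal_frakW[hW NW]; exact: rq.
- apply: (@beta_transfer X _ _ id fst _ _ _ _ fst) => // [U b []//|W].
  by move=> /legal_frakW[hW NW]; exact: rq.
- apply: (@alpha_transfer X _ _ id fst _ _ _ _ fst) => // [U b []//|W].
  move=> /legal_frakW[hW NW] [rV|eV]; first by left; exact: rq.
  by right; split=> //; exact: (frakV_BMstar_set0 eV).
Qed.

Lemma OD_OD_transfer t q t' q' (sel : set X -> set X) :
  (forall M, calN X t' M -> calN X t (sel M) /\ sel M `<=` M) ->
  (forall W, frakW W -> (forall n, calN X t' (W n).2) ->
     frakW_of X q (fun n => ((W n).1, sel (W n).2)) -> frakW_of X q' W) ->
  all_transfer (Gamma_OD t q) (Gamma_OD t' q').
Proof.
move=> selP qq'; pose pi (b : set X * set X) := (b.1, sel b.2).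
have ok_pi U b : OD_ok (calN X t') U b -> OD_ok (calN X t) U (pi b).
  case=> ? ? /selP[? sb] ?; split=> //; exact: subset_trans sb _.
split; [apply: contra_not|apply: contra_not|].
- apply: (@beta_transfer X _ _ fst fst _ _ _ _ pi) => // W.
  by move=> /legal_frakW[hW NW]; exact: qq'.
- apply: (@beta_transfer X _ _ fst fst _ _ _ _ pi) => // W.
  by move=> /legal_frakW[hW NW]; exact: qq'.
- apply: (@alpha_transfer X _ _ fst fst _ _ _ _ pi) => // W.
  by move=> /legal_frakW[hW NW] [/(qq' _ hW NW)|[_ W0]]; [left|right].
Qed.

Lemma Gamma_arrow_transfer A B : Gamma_arrow A B -> all_transfer A B.
Proof.
case.
- exact: (@BM_BM_transfer bm_f bm_k frakV_f_sub_k).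
- exact: (@BM_BM_transfer bm_k bm_p frakV_k_sub_p).
- exact: (@BM_BM_transfer bm_p bm_o frakV_p_sub_o).
- by apply: BM_OD_transfer => W hW _; exact: frakW_k_of_V.
- by apply: BM_OD_transfer => W hW NW; exact: frakW_l_of_V.
- by apply: BM_OD_transfer => W hW NW; exact: frakW_l_of_V.
- have [sel selP] := singleton_selection.
  apply: (@OD_OD_transfer _ _ _ _ sel) => [M [_ /selP[]]//|W hW NW].
  by apply: frakW_of_shrink => // n; case: (NW n) => _ /selP[].
- apply: (@OD_OD_transfer _ _ _ _ id) => [S NS|W hW NW]; first by split.
  move=> /frakW_k_sub_l.
  by under eq_fun do rewrite -surjective_pairing.
- apply: (@OD_OD_transfer _ _ _ _ id) => [S NS|W hW NW]; first by split.
  move=> /frakW_k_sub_l.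
  by under eq_fun do rewrite -surjective_pairing.
- have [sel selP] := singleton_selection.
  apply: (@OD_OD_transfer _ _ _ _ sel) => [M [_ /selP[]]//|W hW NW].
  by apply: frakW_of_shrink => // n; case: (NW n) => _ /selP[].
Qed.

(** * Category *)

(** After the first answer of beta every move of alpha lies inside [O], so only
    the initial moves of alpha have to be required to meet [O]. *)
Lemma category_beta_favorable (start : set (set X)) (O : set X)
    (F : nat -> set X) :
  open O -> (forall U, start U -> open U /\ (O `&` U) !=set0) ->
  (forall n, open (F n) /\ dense (F n)) -> O `&` \bigcap_n F n = set0 ->
  beta_favorable (OD_game start (calN X t_o) (frakW_of X q_l)).
Proof.
move=> Oo startP FP OF0; set G := OD_game _ _ _.
pose V (h : seq (set X * (set X * set X))) U := O `&` U `&` F (size h).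
pose s (h : seq (set X * (set X * set X))) U := (V h U, V h U).
have s_legal h U : @beta_pos G s h -> nested_alegal fst start h U ->
    Tstar (V h U).
  move=> hpos lU.
  have [Uo OU] : open U /\ (O `&` U) !=set0.
    case: hpos lU => [/startP//|h' a _ _ /= [[Uo [x Ux]] Us]].
    by split=> //; exists x; split=> //; case: (Us x Ux) => -[].
  have [Fo Fd] := FP (size h).
  by split; [do 2?apply: openI|apply: Fd => //; exact: openI].
exists s; split=> [h U hpos lU /=|play hplay].
  have TV := s_legal h U hpos lU.
  by split=> //= x [[]].
case=> _ [x [_ Vx]].
have Vxn n : V (past play n) (play n).1 x.
  by have := Vx n I; have [_ /= -> _] := beta_pos_consE (hplay n.+1).
have size_past n : size (past play n) = n by elim: n => //= n ->.
suff : (O `&` \bigcap_n F n) x by rewrite OF0.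
split; first by have [[]] := Vxn 0%N.
by move=> n _; have [_] := Vxn n; rewrite size_past.
Qed.

End Conditions.

Theorem proposition14 (X : topologicalType) :
  (forall A B : Gamma, Gamma_arrow A B ->
     [/\ Gamma_nonmeager A X -> Gamma_nonmeager B X,
         Gamma_Baire A X -> Gamma_Baire B X
       & Gamma_space A X -> Gamma_space B X]) /\
  (Gamma_nonmeager (Gamma_OD t_o q_l) X -> nonmeager_space X) /\
  (Gamma_Baire (Gamma_OD t_o q_l) X -> Baire_space X).
Proof.
split; first by move=> A B; exact: Gamma_arrow_transfer.
split=> betaU F FP.
  apply: contrapT => F0; apply: betaU.
  apply: (@category_beta_favorable _ _ setT F) => //; first exact: openT.
    by move=> U [Uo U0]; rewrite setTI.
  by rewrite setTI; apply/eqP/negPn/negP => /set0P.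
move=> O O0 Oo; apply: contrapT => OF0; apply: betaU.
apply: (@category_beta_favorable _ _ O F) => //.
  by move=> _ ->; split; [exact: openT|rewrite setIT].
by apply/eqP/negPn/negP => /set0P.
Qed.
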